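(* Cluster transformations preserve the Poisson structure on the seed $\mathcal X$-tori: for every seed cluster transformation $\mathbf c:\mathbf i\to\mathbf i'$ the induced birational isomorphism $\mathbf c^x:\mathcal X_{\mathbf i}\to\mathcal X_{\mathbf i'}$ is Poisson with respect to the brackets $\{X_i,X_j\}=\widehat\varepsilon_{ij}X_iX_j$ on $\mathcal X_{\mathbf i}$ and $\{X'_i,X'_j\}=\widehat\varepsilon\,'_{ij}X'_iX'_j$ on $\mathcal X_{\mathbf i'}$. Therefore the space $\mathcal X$ has a Poisson structure.
   Context: A seed $\mathbf i=(I,I_0,\varepsilon,d)$ consists of a finite set $I$, a subset $I_0\subset I$ of frozen elements, a $\mathbb Q$-valued function $\varepsilon=(\varepsilon_{ij})$ on $I\times I$ with $\varepsilon_{ij}\in\mathbb Z$ unless $i,j$ are both in $I_0$, and positive integers $\{d_i\}_{i\in I}$ with greatest common divisor $1$ such that $\widehat\varepsilon_{ij}:=\varepsilon_{ij}d_j^{-1}$ is skew-symmetric. For $k\in I\setminus I_0$ the mutated seed $\mu_k(\mathbf i)=(I,I_0,\varepsilon',d)$ is given by $\varepsilon'_{ij}=-\varepsilon_{ij}$ if $k\in\{i,j\}$; $\varepsilon'_{ij}=\varepsilon_{ij}$ if $k\notin\{i,j\}$ and $\varepsilon_{ik}\varepsilon_{kj}\le 0$; $\varepsilon'_{ij}=\varepsilon_{ij}+|\varepsilon_{ik}|\varepsilon_{kj}$ if $k\notin\{i,j\}$ and $\varepsilon_{ik}\varepsilon_{kj}>0$. $\mathcal X_{\mathbf i}$ is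 the split algebraic torus with coordinates $\{X_i\}_{i\in I}$. A mutation induces the birational map $\mathcal X_{\mathbf i}\to\mathcal X_{\mu_k(\mathbf i)}$, $$\mu_k^*X'_k=X_k^{-1},\qquad \mu_k^*X'_i=X_i(1+X_k^{-\mathrm{sgn}(\varepsilon_{ik})})^{-\varepsilon_{ik}}\ (i\ne k).$$ A seed isomorphism $\sigma$ (a bijection of index sets preserving frozen elements, $\varepsilon$, $d$) induces $\sigma^*X'_{\sigma(i)}=X_i$. A seed cluster transformation is a composition of mutations and seed isomorphisms; $\mathbf c^x$ is the corresponding composition of birational maps. The space $\mathcal X$ is the collection of tori $\mathcal X_{\mathbf i}$, for all seeds equivalent to a given one, together with the gluing birational maps $\mathbf c^x$; a Poisson structure on it is a collection of Poisson structures on these tori preserved by the gluing maps. *)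

(* Defs.v *)
From HB Require Import structures.
From mathcomp Require Import all_boot all_order all_algebra.
From mathcomp Require Import fraction mpoly.

Set Implicit Arguments.
Unset Strict Implicit.
Unset Printing Implicit Defensive.

Import Order.TTheory GRing.Theory Num.Theory.

Local Open Scope ring_scope.

(* Since [\big[gcdn/0]] over the empty set is 0, the gcd condition excludes
   the empty index set. *)
Record seed := Seed {
  idx : finType;
  frozen : {set idx};
  eps : idx -> idx -> rat;
  mult : idx -> nat;
  eps_int : forall i j : idx,
    ~~ ((i \in frozen) && (j \in frozen)) -> eps i j \is a Num.int;
  mult_gt0 : forall i : idx, (0 < mult i)%N;
  mult_gcd : \big[gcdn/0%N]_(i : idx) mult i = 1%N;
  eps_skew : forall i j : idx,
    eps i j / (mult j)%:R = - (eps j i / (mult i)%:R)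
}.

Definition eps_hat (s : seed) (i j : idx s) : rat :=
  eps i j / (mult j)%:R.

Section Mutation.
Variables (s : seed) (k : idx s).

Definition mut_eps (i j : idx s) : rat :=
  if (k == i) || (k == j) then - eps i j
  else if eps i k * eps k j <= 0 then eps i j
  else eps i j + `|eps i k| * eps k j.

Lemma mut_eps_int : k \notin frozen s -> forall i j : idx s,
  ~~ ((i \in frozen s) && (j \in frozen s)) -> mut_eps i j \is a Num.int.
Proof.
move=> hk i j hij; rewrite /mut_eps.
have eij := eps_int hij.
have eik : eps i k \is a Num.int by apply: eps_int; rewrite (negPf hk) andbF.
have ekj : eps k j \is a Num.int by apply: eps_int; rewrite (negPf hk).
case: ifP => _; first by rewrite rpredN.
case: ifP => _ //; rewrite rpredD // rpredM //.
by have [_|_] := ger0P (eps i k); rewrite ?rpredN.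
Qed.

Lemma mut_eps_skew (i j : idx s) :
  mut_eps i j / (mult j)%:R = - (mut_eps j i / (mult i)%:R).
Proof.
have dpos (l : idx s) : (0 : rat) < (mult l)%:R by rewrite ltr0n mult_gt0.
have dne (l : idx s) : (mult l)%:R != 0 :> rat by rewrite gt_eqF.
have eE (a b : idx s) : eps a b = eps_hat a b * (mult b)%:R.
  by rewrite /eps_hat divfK.
have hskew (a b : idx s) : eps_hat a b = - eps_hat b a by exact: eps_skew.
rewrite /mut_eps orbC; case: ifP => _.
  by rewrite !mulNr (eps_skew i j).
have -> : (eps j k * eps k i <= 0) = (eps i k * eps k j <= 0).
  rewrite (eE j k) (eE k i) (eE i k) (eE k j) (hskew j k) (hskew k i).
  rewrite mulrACA mulrNN [in RHS]mulrACA (mulrC (eps_hat k j)).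
  by rewrite !(pmulr_lle0 _ (mulr_gt0 (dpos _) (dpos _))).
case: ifP => [_|]; first exact: eps_skew.
move=> /negbT; rewrite -ltNge => hpos.
rewrite !mulrDl opprD -eps_skew; congr (_ + _).
rewrite -!mulrA -/(eps_hat k j) -/(eps_hat k i).
have {hpos} : 0 < eps_hat i k * eps_hat k j.
  by move: hpos; rewrite (eE i k) (eE k j) mulrACA
    (pmulr_lgt0 _ (mulr_gt0 (dpos k) (dpos j))).
rewrite (eE i k) (eE j k) (normrM (eps_hat i k)) (normrM (eps_hat j k)) => hpos.
rewrite (gtr0_norm (dpos k)) (hskew k i) (hskew j k) normrN.
rewrite mulrN opprK; move: (mult k)%:R (eps_hat i k) (eps_hat k j) hpos.
move=> d x y hpos; rewrite mulrAC [RHS]mulrAC; congr (_ * _).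
have [h|h|h] := ltrgt0P x.
- by move: hpos; rewrite (pmulr_rgt0 _ h) => /gtr0_norm ->; rewrite mulrC.
- move: hpos; rewrite (nmulr_rgt0 _ h) => /ltr0_norm ->.
  by rewrite !mulNr mulrC.
- by move: hpos; rewrite h mul0r ltxx.
Qed.

Definition mutate (hk : k \notin frozen s) : seed :=
  Seed (mut_eps_int hk) (@mult_gt0 s) (mult_gcd s) mut_eps_skew.

End Mutation.

Record seed_iso (s s' : seed) := SeedIso {
  iso_fun : idx s -> idx s';
  iso_inv : idx s' -> idx s;
  iso_funK : cancel iso_fun iso_inv;
  iso_invK : cancel iso_inv iso_fun;
  iso_frozen : forall i, (iso_fun i \in frozen s') = (i \in frozen s);
  iso_eps : forall i j, eps (iso_fun i) (iso_fun j) = eps i j;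
  iso_mult : forall i, mult (iso_fun i) = mult i
}.

(* [CComp c1 c2] is [c1] followed by [c2]. *)
Inductive cluster_trans : seed -> seed -> Type :=
| CMut (s : seed) (k : idx s) (hk : k \notin frozen s) :
    cluster_trans s (mutate hk)
| CIso (s s' : seed) (sigma : seed_iso s s') : cluster_trans s s'
| CComp (s1 s2 s3 : seed) (c1 : cluster_trans s1 s2)
    (c2 : cluster_trans s2 s3) : cluster_trans s1 s3.

Definition seed_equiv (s s' : seed) : Prop := inhabited (cluster_trans s s').

(* The torus X_s over F is handled through its function field, its ring of
   regular functions (the Laurent polynomials) and its coordinates. *)
Definition torus_field (F : fieldType) (s : seed) : fieldType :=
  {fraction {mpoly F[#|idx s|]}}.

Section Torus.
Variables (F : fieldType) (s : seed).
Local Notation K := (torus_field F s).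

Definition torus_const (c : F) : K :=
  @tofrac {mpoly F[#|idx s|]} (c%:MP).

Definition coord (i : idx s) : K :=
  @tofrac {mpoly F[#|idx s|]} ('X_(enum_rank i)).

Definition regular (f : K) : Prop :=
  exists (p : {mpoly F[#|idx s|]}) (m : 'X_{1..#|idx s|}),
    f = @tofrac {mpoly F[#|idx s|]} p / @tofrac {mpoly F[#|idx s|]} 'X_[m].

(* A Poisson structure on the torus is a Poisson bracket on its Laurent
   polynomial ring.  Such a bracket extends uniquely to the function field, and
   birational maps only act there, so it is represented by its extension: a
   Poisson bracket on the function field under which the Laurent polynomials
   are closed. *)
Record poisson_structure (B : K -> K -> K) : Prop := PoissonStructure {
  pb_linear : forall (c : F) (f g h : K),
    B (torus_const c * f + g) h = torus_const c * B f h + B g h;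
  pb_skew : forall f g : K, B f g = - B g f;
  pb_leibniz : forall f g h : K, B f (g * h) = B f g * h + g * B f h;
  pb_jacobi : forall f g h : K,
    B f (B g h) + B g (B h f) + B h (B f g) = 0;
  pb_regular : forall f g : K, regular f -> regular g -> regular (B f g)
}.

Definition cluster_bracket (B : K -> K -> K) : Prop :=
  poisson_structure B /\
  forall i j : idx s,
    B (coord i) (coord j) = ratr (eps_hat i j) * coord i * coord j.

End Torus.

Section Maps.
Variable F : fieldType.

(* The rational map X_s --> X_s' with components [v j = phi^* X'_j], as its
   pullback on rational functions: substitution of [v] in the numerator and the
   denominator.  It does not depend on the representative chosen by [repr] when
   the [v j] are algebraically independent, i.e. when the map is dominant. *)
Definition pullback_of (s s' : seed) (v : idx s' -> torus_field F s)
    (f : torus_field F s') : torus_field F s :=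
  let subst (p : {mpoly F[#|idx s'|]}) : torus_field F s :=
    mmap (@torus_const F s) (fun a => v (enum_val a)) p in
  let r : {ratio {mpoly F[#|idx s'|]}} := repr f in
  subst (\n_r) / subst (\d_r).

(* [numq] turns the integer [eps i k : rat] (k is not frozen) into an [int]. *)
Definition mut_coord (s : seed) (k i : idx s) : torus_field F s :=
  if i == k then (coord F k)^-1
  else coord F i *
       (1 + coord F k ^ (- sgz (eps i k))) ^ (- numq (eps i k)).

Fixpoint cluster_pullback (s s' : seed) (c : cluster_trans s s') :
    torus_field F s' -> torus_field F s :=
  match c in cluster_trans s s' return torus_field F s' -> torus_field F s with
  | @CMut s k hk => @pullback_of s (mutate hk) (@mut_coord s k)
  | @CIso s s' sigma => @pullback_of s s' (fun j => coord F (iso_inv sigma j))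
  | @CComp _ _ _ c1 c2 => fun f => cluster_pullback c1 (cluster_pullback c2 f)
  end.

(* [phi] is the pullback of a birational isomorphism X_s --> X_s' over F. *)
Record birational_iso (s s' : seed)
    (phi : torus_field F s' -> torus_field F s) : Prop := BirationalIso {
  bi_add : GRing.zmod_morphism phi;
  bi_mul : GRing.monoid_morphism phi;
  bi_const : forall c : F, phi (torus_const s' c) = torus_const s c;
  bi_bij : bijective phi
}.

Definition poisson_map (s s' : seed)
    (B : torus_field F s -> torus_field F s -> torus_field F s)
    (B' : torus_field F s' -> torus_field F s' -> torus_field F s')
    (phi : torus_field F s' -> torus_field F s) : Prop :=
  forall f g : torus_field F s', phi (B' f g) = B (phi f) (phi g).

(* A Poisson structure on the space X attached to [s0]; only the brackets
   [P s] with [s] equivalent to [s0] are relevant. *)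
Definition space_poisson_structure (s0 : seed)
    (P : forall s : seed,
      torus_field F s -> torus_field F s -> torus_field F s) : Prop :=
  (forall s : seed, seed_equiv s0 s -> poisson_structure (P s)) /\
  (forall (s s' : seed) (c : cluster_trans s s'),
     seed_equiv s0 s -> seed_equiv s0 s' ->
     poisson_map (P s) (P s') (cluster_pullback c)).

End Maps.

Arguments cluster_pullback F {s s'} c f.

(* Main.v *)
From HB Require Import structures.
From mathcomp Require Import all_boot all_order all_algebra.
From mathcomp Require Import fraction mpoly ring.
Require Import Defs.

Set Implicit Arguments.
Unset Strict Implicit.
Unset Printing Implicit Defensive.

Import Order.TTheory GRing.Theory Num.Theory.
Local Open Scope ring_scope.

(** A cluster transformation is a composition of mutations and seed
    isomorphisms, so it is enough to treat these two, provided that every seed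
    in between carries a cluster bracket.

    Existence of the brackets.  The Euler derivations [E_i = X_i d/dX_i] extend
    to rational functions by the quotient rule, and
    [{f, g} = sum_(i, j) eps_hat i j * E_i f * E_j g] is a skew biderivation
    with the prescribed values on coordinates
    ([log_canonical_cluster_bracket]).  Its Jacobiator is a derivation in each
    argument, so the Jacobi identity has to be verified only on coordinates,
    where it follows from the skew-symmetry of [eps_hat].

    Birationality.  If substituting [w] into the components of [v] gives back
    the coordinates, then substitution of [v] kills no nonzero polynomial
    ([subst_inj]); if the same holds with [v] and [w] exchanged, the two
    pullbacks are mutually inverse field isomorphisms ([pullback_birational]).
    The inverse of a mutation is the mutation at the same index of the mutated
    seed, whose column [eps i k] has the opposite sign
    ([exchange_coord_left_inverse]).

    Poisson property.  A bracket is determined by its values on coordinates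
    ([poisson_map_of_coord]), so the brackets of the mutated coordinates
    [X'_i] have to be computed.  This is best done with the bracket of
    logarithms [{f, g} / (f g)], which is additive on products.  For
    [i, j <> k] write [theta_z] for the logarithmic derivative of
    [1 + X_k^(-z)] in [log X_k]; then the bracket of [log X'_i] and
    [log X'_j] is
    [eps_hat i j - eps j k theta_(sgn (eps j k)) eps_hat i k
       + eps i k theta_(sgn (eps i k)) eps_hat j k].
    With [eps i k = d_k eps_hat i k] the last two terms combine to
    [d_k eps_hat i k eps_hat j k (theta_(sgn (eps i k)) - theta_(sgn (eps j k)))].
    This is zero unless [eps_hat i k] and [eps_hat j k] have opposite signs, in
    which case [theta_(-1) - theta_1 = 1] makes it the constant
    [- `|eps_hat i k| eps_hat j k d_k], and the result is the mutated matrix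
    ([mutation_log_bracket]). *)

Local Notation repr := generic_quotient.repr.

(** * Rational constants in a field of characteristic zero *)
Section RationalsInFieldOfCharZero.
Variables (K : fieldType) (charK0 : [pchar K] =i pred0).

Lemma intr_eq0_pchar0 (z : int) : (z%:~R == 0 :> K) = (z == 0).
Proof.
have natP (n : nat) : (n%:R == 0 :> K) = (n == 0)%N.
  by case: (pcharf0P K) => + _; apply.
by case: z => n; rewrite ?NegzE ?mulrNz ?oppr_eq0 natP.
Qed.

(** [ratr] reads off the reduced fraction; in characteristic zero any other
    representative gives the same value, which is what makes [ratr] additive
    and multiplicative. *)
Lemma ratr_frac (a b : int) : b != 0 -> ratr (a%:~R / b%:~R) = a%:~R / b%:~R :> K.
Proof.
move=> b0; set q := _ / _ : rat.
have cross : numq q * b = a * denq q.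
  apply: (@intr_inj rat); rewrite !rmorphM /= numqE mulrAC /q divfK //.
  by rewrite intr_eq0.
apply/eqP; rewrite eqr_div ?intr_eq0_pchar0 ?denq_neq0 //.
by rewrite -!intrM cross.
Qed.

Lemma ratrD_pchar0 : {morph @ratr K : x y / x + y}.
Proof.
move=> x y; rewrite -{1}[x]divq_num_den -{1}[y]divq_num_den.
have [dx dy] := (denq_neq0 x, denq_neq0 y).
rewrite addf_div ?intr_eq0 // -!intrM -intrD ratr_frac ?mulf_neq0 //.
by rewrite intrD !intrM -addf_div ?intr_eq0_pchar0.
Qed.

Lemma ratrM_pchar0 : {morph @ratr K : x y / x * y}.
Proof.
move=> x y; rewrite -{1}[x]divq_num_den -{1}[y]divq_num_den.
have [dx dy] := (denq_neq0 x, denq_neq0 y).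
by rewrite mulf_div -!intrM ratr_frac ?mulf_neq0 // !intrM -mulf_div.
Qed.

Lemma ratrN_field (x : rat) : ratr (- x) = - ratr x :> K.
Proof. by rewrite /ratr numqN denqN intrN mulNr. Qed.

End RationalsInFieldOfCharZero.

(** * Fields of fractions and rational functions *)

Lemma fraction_repr (R : idomainType) (f : {fraction R}) :
  f = @tofrac R (\n_(repr f)) / @tofrac R (\d_(repr f)).
Proof.
set r := repr f.
have d0 : \d_r != 0 by [].
apply/(canRL (mulfK _)); first by rewrite tofrac_eq0.
rewrite -[f]generic_quotient.reprK -/r.
unlock tofrac; rewrite -[LHS]FracField.pi_mul; apply/generic_quotient.eqmodP.
rewrite /= FracField.equivfE /FracField.mulf /= !numden_Ratio ?oner_neq0 ?mulr1 //.
by rewrite mulrC.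
Qed.

Section RationalFunctions.
Variables (F : fieldType) (n : nat).
Local Notation P := {mpoly F[n]}.
Local Notation K := {fraction P}.

Lemma mpoly_ring_ind (Q : P -> Prop) :
  (forall c, Q c%:MP) -> (forall i, Q 'X_i) ->
  (forall p q, Q p -> Q q -> Q (p + q)) ->
  (forall p q, Q p -> Q q -> Q (p * q)) -> forall p, Q p.
Proof.
move=> QC QX QD QM; elim/mpolyind=> [|c m p _ _ Qp]; first exact: (QC 0).
apply: (QD) => //; rewrite -mul_mpolyC; apply: (QM) => //.
rewrite mpolyXE_id; elim/big_rec: _ => [|i q _ Qq]; first exact: (QC 1).
apply: (QM) => //; elim: (m i) => [|k IHk]; first exact: (QC 1).
by rewrite exprS; apply: QM.
Qed.

(** Constants and variables generate the field of rational functions: two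
    derivations, or two field morphisms, that agree on them are equal. *)
Lemma fraction_field_ind (Q : K -> Prop) :
  (forall c, Q (@tofrac P c%:MP)) -> (forall i, Q (@tofrac P 'X_i)) ->
  (forall f g, Q f -> Q g -> Q (f + g)) ->
  (forall f g, Q f -> Q g -> Q (f * g)) ->
  (forall f, f != 0 -> Q f -> Q f^-1) -> forall f, Q f.
Proof.
move=> QC QX QD QM QV f.
have QP p : Q (@tofrac P p).
  elim/mpoly_ring_ind: p => // p q Qp Qq.
    by rewrite tofracD; apply: QD.
  by rewrite tofracM; apply: QM.
rewrite (fraction_repr f); apply: (QM) => //; apply: QV => //.
by rewrite tofrac_eq0 denom_ratioP.
Qed.

End RationalFunctions.

(** * Derivations along a field morphism *)
Section Derivations.
Variables (K L : fieldType) (phi : {rmorphism K -> L}).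

(** Derivations along [phi] cover at once the derivations of a field
    ([phi] the identity) and the two ways of combining a bracket with a change of
    variables, [g |-> phi (B' f g)] and [g |-> B (phi f) (phi g)]. *)
Definition derivation_along (D : K -> L) : Prop :=
  {morph D : f g / f + g} /\ forall f g, D (f * g) = D f * phi g + phi f * D g.

Variable D : K -> L.
Hypothesis derD : derivation_along D.

Lemma deriv1 : D 1 = 0.
Proof.
have := derD.2 1 1; rewrite !mulr1 rmorph1 mul1r mulr1.
by move/(canLR (addrK _)); rewrite subrr.
Qed.

Lemma deriv0 : D 0 = 0.
Proof.
by have := derD.1 0 0; rewrite addr0 => /(canLR (addrK _)); rewrite subrr.
Qed.

Lemma derivV f : f != 0 -> D f^-1 = - D f / phi f ^+ 2.
Proof.
move=> f0; have phif0 : phi f != 0 by rewrite fmorph_eq0.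
have := derD.2 f f^-1; rewrite mulfV // deriv1 fmorphV => /esym/eqP.
rewrite addr_eq0 => /eqP h; apply: (mulfI phif0).
by rewrite -[LHS]opprK -h; field.
Qed.

Definition dlog f := D f / phi f.

Lemma dlog1 : dlog 1 = 0. Proof. by rewrite /dlog deriv1 mul0r. Qed.

Lemma dlogM f g : f != 0 -> g != 0 -> dlog (f * g) = dlog f + dlog g.
Proof.
move=> f0 g0; rewrite /dlog derD.2 rmorphM.
by field; rewrite !fmorph_eq0 f0 g0.
Qed.

Lemma dlogV f : f != 0 -> dlog f^-1 = - dlog f.
Proof.
move=> f0; rewrite /dlog derivV // fmorphV.
by field; rewrite fmorph_eq0 f0 oner_neq0.
Qed.

Lemma dlogXz f (z : int) : f != 0 -> dlog (f ^ z) = z%:~R * dlog f.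
Proof.
move=> f0; have pos (k : nat) : dlog (f ^+ k) = k%:R * dlog f.
  elim: k => [|k IHk]; first by rewrite dlog1 mul0r.
  by rewrite exprS dlogM ?expf_neq0 // IHk -natr1 mulrDl mul1r addrC.
case: z => k; first by rewrite -exprnP pos.
by rewrite NegzE -exprnN dlogV ?expf_neq0 // pos intrN mulNr.
Qed.

End Derivations.

(** * Substitution of rational functions *)
Section Substitution.
Variables (F : fieldType) (n : nat) (L : fieldType).
Variables (c : {rmorphism F -> L}) (w : 'I_n -> L).
Local Notation P := {mpoly F[n]}.
Local Notation psi := (mmap c w).

(** Graph of the partial map that substitutes [w] into rational functions; it
    is defined at [f] when [f] has a fraction whose denominator does not vanish
    under the substitution.  Working with a relation allows one to compute with
    it before [w] is known to be algebraically independent. *)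
Definition specializes (f : {fraction P}) (g : L) : Prop :=
  exists a s : P, [/\ psi s != 0, f = @tofrac P a / @tofrac P s & g = psi a / psi s].

Lemma subst_denom_neq0 s : psi s != 0 -> @tofrac P s != 0.
Proof. by apply: contra; rewrite tofrac_eq0 => /eqP ->; rewrite rmorph0. Qed.

(** Cross-multiplication takes place in the polynomial ring, where the
    substitution is a total ring morphism. *)
Lemma specializes_uniq f g g' : specializes f g -> specializes f g' -> g = g'.
Proof.
move=> [a [s [s0 -> ->]]] [b [t [t0 /eqP e ->]]].
move: e; rewrite eqr_div ?subst_denom_neq0 // -!tofracM tofrac_eq => /eqP e.
by apply/eqP; rewrite eqr_div // -!rmorphM e.
Qed.

Lemma specializes_poly p : specializes (@tofrac P p) (psi p).
Proof. by exists p, 1; rewrite !rmorph1 !divr1 oner_neq0. Qed.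

Lemma specializesC a : specializes (@tofrac P a%:MP) (c a).
Proof. by have := specializes_poly a%:MP; rewrite mmapC. Qed.

Lemma specializesX i : specializes (@tofrac P 'X_i) (w i).
Proof. by have := specializes_poly 'X_i; rewrite mmapX mmap1U. Qed.

Lemma specializesD f g f' g' :
  specializes f f' -> specializes g g' -> specializes (f + g) (f' + g').
Proof.
move=> [a [s [s0 -> ->]]] [b [t [t0 -> ->]]].
exists (a * t + b * s), (s * t).
by rewrite !addf_div ?subst_denom_neq0 // !rmorphM !rmorphD !rmorphM /= mulf_neq0.
Qed.

Lemma specializesM f g f' g' :
  specializes f f' -> specializes g g' -> specializes (f * g) (f' * g').
Proof.
move=> [a [s [s0 -> ->]]] [b [t [t0 -> ->]]].
exists (a * b), (s * t).
by rewrite !mulf_div !rmorphM /= mulf_neq0.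
Qed.

Lemma specializesV f g : g != 0 -> specializes f g -> specializes f^-1 g^-1.
Proof.
move=> g0 [a [s [s0 fE gE]]]; exists s, a; rewrite fE gE !invf_div; split => //.
by apply: contraNneq g0 => a0; rewrite gE a0 mul0r.
Qed.

Lemma specializesXz f g (z : int) :
  g != 0 -> specializes f g -> specializes (f ^ z) (g ^ z).
Proof.
move=> g0 fg; have pos k : specializes (f ^+ k) (g ^+ k).
  elim: k => [|k IHk]; last by rewrite !exprS; apply: specializesM.
  by have := specializesC 1; rewrite !rmorph1.
case: z => k; first by rewrite -!exprnP.
by rewrite NegzE -!exprnN; apply: specializesV => //; rewrite expf_neq0.
Qed.

(** When no nonzero polynomial is killed, the substitution is everywhere
    defined and this formula, which uses one chosen fraction, computes it. *)
Definition frac_subst (f : {fraction P}) : L :=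
  psi (\n_(repr f)) / psi (\d_(repr f)).

Hypothesis psi_inj : forall p, psi p = 0 -> p = 0.

Lemma specializes_subst f : specializes f (frac_subst f).
Proof.
exists (\n_(repr f)), (\d_(repr f)); split.
- have : \d_(repr f) != 0 by [].
  by apply: contra => /eqP/psi_inj/eqP.
- exact: fraction_repr.
- by [].
Qed.

Lemma frac_substE f g : specializes f g -> frac_subst f = g.
Proof. exact/specializes_uniq/specializes_subst. Qed.

Lemma frac_subst_zmod : GRing.zmod_morphism frac_subst.
Proof.
move=> f g; have sub := specializes_subst.
apply: frac_substE; rewrite -(mulN1r g) -(mulN1r (frac_subst g)).
apply: specializesD => //; apply: specializesM => //.
by have := specializesC (-1); rewrite !rmorphN !rmorph1.
Qed.

Lemma frac_subst_monoid : GRing.monoid_morphism frac_subst.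
Proof.
split=> [|f g]; apply: frac_substE.
  by have := specializesC 1; rewrite !rmorph1.
by apply: specializesM; apply: specializes_subst.
Qed.

End Substitution.

(** * Function fields of seed tori *)
HB.instance Definition _ (F : fieldType) (s : seed) :=
  GRing.RMorphism.copy (@torus_const F s)
    (@tofrac {mpoly F[#|idx s|]} \o @mpolyC #|idx s| F).

Section TorusField.
Variables (F : fieldType) (s : seed).
Local Notation K := (torus_field F s).

Lemma torus_field_ind (Q : K -> Prop) :
  (forall c, Q (torus_const s c)) -> (forall i, Q (coord F i)) ->
  (forall f g, Q f -> Q g -> Q (f + g)) ->
  (forall f g, Q f -> Q g -> Q (f * g)) ->
  (forall f, f != 0 -> Q f -> Q f^-1) -> forall f, Q f.
Proof.
move=> QC QX QD QM QV; apply: fraction_field_ind => // i.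
by have := QX (enum_val i); rewrite /coord enum_valK.
Qed.

Lemma torus_derivation_ext (L : fieldType) (phi : {rmorphism K -> L})
    (D1 D2 : K -> L) :
  derivation_along phi D1 -> derivation_along phi D2 ->
  (forall c, D1 (torus_const s c) = D2 (torus_const s c)) ->
  (forall i, D1 (coord F i) = D2 (coord F i)) -> D1 =1 D2.
Proof.
move=> der1 der2 eqC eqX; elim/torus_field_ind => //.
- by move=> f g ef eg; rewrite der1.1 der2.1 ef eg.
- by move=> f g ef eg; rewrite der1.2 der2.2 ef eg.
- by move=> f f0 ef; rewrite (derivV der1 f0) (derivV der2 f0) ef.
Qed.

Lemma coord_neq0 (i : idx s) : coord F i != 0.
Proof.
rewrite /coord tofrac_eq0; apply/eqP => /(congr1 (mcoeff U_(enum_rank i))).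
by rewrite mcoeffX mcoeff0 eqxx => /eqP; rewrite oner_eq0.
Qed.

Lemma coordD1_neq0 (i : idx s) : 1 + coord F i != 0.
Proof.
rewrite /coord -tofrac1 -tofracD tofrac_eq0.
apply/eqP => /(congr1 (mcoeff U_(enum_rank i))).
rewrite mcoeffD mcoeffX mcoeff0 mcoeff1 eqxx mnm1_eq0 add0r => /eqP.
by rewrite oner_eq0.
Qed.

Lemma torus_pchar0 : [pchar F] =i pred0 -> [pchar K] =i pred0.
Proof. by move=> h p; rewrite (fmorph_pchar (torus_const s : {rmorphism F -> K})). Qed.

(** Characteristic zero enters for [z = 0], where the factor is [2]. *)
Lemma mutation_factor_neq0 (z : rat) (i : idx s) : [pchar F] =i pred0 ->
  1 + coord F i ^ (- sgz z) != 0.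
Proof.
move=> /torus_pchar0 charK; case: sgzP => _; rewrite ?oppr0 ?expr0z.
- have -> : 1 + 1 = 2%:~R :> K by [].
  by rewrite intr_eq0_pchar0.
- rewrite exprN1 -[X in X + _](mulfV (coord_neq0 i)) -[X in _ + X]mul1r.
  by rewrite -mulrDl addrC mulf_neq0 ?coordD1_neq0 ?invr_eq0 ?coord_neq0.
- by rewrite opprK expr1z coordD1_neq0.
Qed.

End TorusField.

(** On pullbacks [w^* v^* = id]; on rational maps [v] after [w] is the identity.
    It is phrased with [specializes] because [w^*] has a meaning only once [w] is
    known to be dominant. *)
Definition pullback_left_inverse (F : fieldType) (s1 s2 : seed)
    (v : idx s2 -> torus_field F s1)
    (w : idx s1 -> torus_field F s2) : Prop :=
  forall j, specializes (@torus_const F s2) (fun a => w (enum_val a))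
    (v j) (coord F j).

Section Pullback.
Variables (F : fieldType) (s s' : seed).
Variables (v : idx s' -> torus_field F s) (w : idx s -> torus_field F s').

(** A one-sided inverse forces the components of [v] to be algebraically
    independent: substituting [w] into the polynomial [p] of the [v j] must give
    back [p], so [p] vanishes as soon as its value at [v] does. *)
Lemma subst_inj : pullback_left_inverse v w ->
  forall p : {mpoly F[#|idx s'|]},
    mmap (@torus_const F s) (fun a => v (enum_val a)) p = 0 -> p = 0.
Proof.
move=> vw p p0.
have spec_p : specializes (@torus_const F s') (fun a => w (enum_val a))
    (mmap (@torus_const F s) (fun a => v (enum_val a)) p) (@tofrac _ p).
  elim/mpoly_ring_ind: p {p0} => [c|i|p q hp hq|p q hp hq].
  - rewrite mmapC; exact: specializesC.
  - by rewrite mmapX mmap1U; have := vw (enum_val i); rewrite /coord enum_valK.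
  - by rewrite rmorphD tofracD; apply: specializesD.
  - by rewrite rmorphM tofracM; apply: specializesM.
apply/eqP; rewrite -tofrac_eq0; apply/eqP.
apply: specializes_uniq spec_p _; rewrite p0.
by have := specializesC (@torus_const F s') (fun a => w (enum_val a)) 0;
  rewrite !rmorph0.
Qed.

End Pullback.

Section PullbackIso.
Variables (F : fieldType) (s s' : seed).
Variables (v : idx s' -> torus_field F s) (w : idx s -> torus_field F s').
Hypothesis vw : pullback_left_inverse v w.

Lemma pullback_specE f g :
  specializes (@torus_const F s) (fun a => v (enum_val a)) f g ->
  pullback_of v f = g.
Proof. exact: (frac_substE (subst_inj vw)). Qed.

Lemma pullback_coord j : pullback_of v (coord F j) = v j.
Proof.
apply: pullback_specE; rewrite -[in X in specializes _ _ _ X](enum_rankK j).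
exact: specializesX.
Qed.

Lemma pullback_const c : pullback_of v (torus_const s' c) = torus_const s c.
Proof. by apply: pullback_specE; exact: specializesC. Qed.

Lemma pullback_zmod : GRing.zmod_morphism (pullback_of v).
Proof. exact: (frac_subst_zmod (subst_inj vw)). Qed.

Lemma pullback_monoid : GRing.monoid_morphism (pullback_of v).
Proof. exact: (frac_subst_monoid (subst_inj vw)). Qed.

End PullbackIso.

(** The composite is a field morphism that fixes constants and coordinates. *)
Lemma pullbackK (F : fieldType) (s s' : seed)
    (v : idx s' -> torus_field F s) (w : idx s -> torus_field F s') :
  pullback_left_inverse v w -> pullback_left_inverse w v ->
  cancel (pullback_of v) (pullback_of w).
Proof.
move=> vw wv.
pose fv : {rmorphism torus_field F s' -> torus_field F s} :=
  HB.pack (pullback_of v) (GRing.isZmodMorphism.Build _ _ _ (pullback_zmod vw))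
    (GRing.isMonoidMorphism.Build _ _ _ (pullback_monoid vw)).
pose fw : {rmorphism torus_field F s -> torus_field F s'} :=
  HB.pack (pullback_of w) (GRing.isZmodMorphism.Build _ _ _ (pullback_zmod wv))
    (GRing.isMonoidMorphism.Build _ _ _ (pullback_monoid wv)).
rewrite -[pullback_of v]/(fv : _ -> _) -[pullback_of w]/(fw : _ -> _).
elim/torus_field_ind => [c|j|f g ef eg|f g ef eg|f _ ef].
- by rewrite /= (pullback_const vw) (pullback_const wv).
- by rewrite /= (pullback_coord vw); apply: (pullback_specE wv).
- by rewrite !rmorphD ef eg.
- by rewrite (rmorphM fv) (rmorphM fw) ef eg.
- by rewrite !fmorphV ef.
Qed.

Lemma pullback_birational (F : fieldType) (s s' : seed)
    (v : idx s' -> torus_field F s) (w : idx s -> torus_field F s') :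
  pullback_left_inverse v w -> pullback_left_inverse w v -> birational_iso (pullback_of v).
Proof.
move=> vw wv; split.
- exact: pullback_zmod vw.
- exact: pullback_monoid vw.
- exact: pullback_const vw.
- by exists (pullback_of w); apply: pullbackK.
Qed.

(** * Mutations and isomorphisms are birational *)
Section MutationBirational.
Variables (F : fieldType) (charF0 : [pchar F] =i pred0).

(** The mutation formula with the column [i |-> eps i k] replaced by an
    arbitrary [r], so that a mutation and its inverse are treated together on
    one torus. *)
Definition exchange_coord (s : seed) (k : idx s) (r : idx s -> rat) (i : idx s) :
    torus_field F s :=
  if i == k then (coord F k)^-1
  else coord F i * (1 + coord F k ^ (- sgz (r i))) ^ (- numq (r i)).

(** The pivot is inverted, so [1 + X_k^(-z)] becomes [1 + X_k^z]; as the
    column changes sign too, the factor introduced by one map cancels the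
    factor introduced by the other. *)
Lemma exchange_coord_left_inverse (s : seed) (k : idx s) (r r' : idx s -> rat) :
  (forall i, r' i = - r i) ->
  pullback_left_inverse (exchange_coord k r) (exchange_coord k r').
Proof.
move=> r'E j.
set c := @torus_const F s; set w := fun a : 'I_#|idx s| => _.
have spec_w i : specializes c w (coord F i) (exchange_coord k r' i).
  by have := specializesX c w (enum_rank i); rewrite /w enum_rankK.
have wk : exchange_coord k r' k = (coord F k)^-1 by rewrite /exchange_coord eqxx.
have spec_k (z : int) : specializes c w (coord F k ^ z) (coord F k ^ (- z)).
  rewrite -exprz_inv -wk; apply: specializesXz => //.
  by rewrite wk invr_eq0 coord_neq0.
rewrite /(exchange_coord k r j); case: eqP => [->|/eqP jk].
  by have := spec_k (-1); rewrite opprK expr1z exprN1.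
have fac0 z := @mutation_factor_neq0 F s z k charF0.
have e : coord F j = exchange_coord k r' j * (1 + coord F k ^ (sgz (r j))) ^ (- numq (r j)).
  rewrite /exchange_coord (negPf jk) r'E sgzN numqN !opprK -mulrA -expfzDr ?subrr ?mulr1 //.
  by have := fac0 (- r j); rewrite sgzN opprK.
rewrite [X in specializes _ _ _ X]e.
apply: specializesM => //; apply: specializesXz.
  by have := fac0 (- r j); rewrite sgzN opprK.
apply: specializesD; last by have := spec_k (- sgz (r j)); rewrite opprK.
by have := specializesC c w 1; rewrite !rmorph1.
Qed.

Lemma mutation_left_inverses (s : seed) (k : idx s) (hk : k \notin frozen s) :
  @pullback_left_inverse F s (mutate hk) (@mut_coord F s k) (@mut_coord F (mutate hk) k) /\
  @pullback_left_inverse F (mutate hk) s (@mut_coord F (mutate hk) k) (@mut_coord F s k).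
Proof.
have mutE (i : idx s) : @eps (mutate hk) i k = - @eps s i k.
  by rewrite /= /mut_eps eqxx orbT.
split.
  exact: (@exchange_coord_left_inverse s k (fun i => eps i k)
            (fun i : idx s => @eps (mutate hk) i k)).
apply: (@exchange_coord_left_inverse s k (fun i : idx s => @eps (mutate hk) i k)
            (fun i => eps i k)) => i.
by rewrite mutE opprK.
Qed.

Lemma iso_left_inverses (s s' : seed) (sigma : seed_iso s s') :
  @pullback_left_inverse F s s' (fun j => coord F (iso_inv sigma j))
    (fun i => coord F (iso_fun sigma i)) /\
  @pullback_left_inverse F s' s (fun i => coord F (iso_fun sigma i))
    (fun j => coord F (iso_inv sigma j)).
Proof.
split=> i.
  rewrite -[in X in specializes _ _ _ X](iso_invK sigma i).
  rewrite -[in X in specializes _ _ _ X](enum_rankK (iso_inv sigma i)).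
  exact: specializesX.
rewrite -[in X in specializes _ _ _ X](iso_funK sigma i).
rewrite -[in X in specializes _ _ _ X](enum_rankK (iso_fun sigma i)).
exact: specializesX.
Qed.

Lemma cluster_pullback_birational (s s' : seed) (c : cluster_trans s s') :
  birational_iso (cluster_pullback F c).
Proof.
elim: c => {s s'} [s k hk|s s' sigma|s1 s2 s3 c1 [a1 m1 k1 b1] c2 [a2 m2 k2 b2]] /=.
- by have [vw wv] := mutation_left_inverses hk; apply: pullback_birational wv.
- by have [vw wv] := iso_left_inverses sigma; apply: pullback_birational wv.
- split.
  + by move=> f g; rewrite a2 a1.
  + by split=> [|f g]; rewrite ?(m2.1, m2.2) ?(m1.1, m1.2).
  + by move=> c; rewrite k2 k1.
  + exact: bij_comp.
Qed.

End MutationBirational.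

(** * Extension of a derivation to the field of fractions *)
Lemma quotient_ruleD (L : fieldType) (a s b t da ds db dt : L) : s != 0 -> t != 0 ->
  ((da * t + a * dt + (db * s + b * ds)) * (s * t)
    - (a * t + b * s) * (ds * t + s * dt)) / (s * t) ^+ 2
  = (da * s - a * ds) / s ^+ 2 + (db * t - b * dt) / t ^+ 2.
Proof. by move=> s0 t0; field; rewrite s0 t0. Qed.

Lemma quotient_ruleM (L : fieldType) (a s b t da ds db dt : L) : s != 0 -> t != 0 ->
  ((da * b + a * db) * (s * t) - a * b * (ds * t + s * dt)) / (s * t) ^+ 2
  = (da * s - a * ds) / s ^+ 2 * (b / t) + a / s * ((db * t - b * dt) / t ^+ 2).
Proof. by move=> s0 t0; field; rewrite s0 t0. Qed.

Section FractionDerivation.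
Variables (R : idomainType) (delta : R -> R).
Hypotheses (deltaD : {morph delta : p q / p + q}).
Hypotheses (deltaM : forall p q, delta (p * q) = delta p * q + p * delta q).
Local Notation K := {fraction R}.
Local Notation "x %:F" := (@tofrac R x).

Definition quotient_rule (a s : R) : K := (delta a * s - a * delta s)%:F / (s%:F ^+ 2).

(** Differentiate [a * t = b * s] and eliminate. *)
Lemma quotient_rule_wd (a s b t : R) : s != 0 -> t != 0 ->
  a * t = b * s -> quotient_rule a s = quotient_rule b t.
Proof.
move=> s0 t0 e; have := congr1 delta e; rewrite !deltaM => de.
apply/eqP; rewrite eqr_div ?expf_neq0 ?tofrac_eq0 // -!tofracXn -!tofracM tofrac_eq.
apply/eqP.
have -> : (delta a * s - a * delta s) * t ^+ 2 =
          (delta a * t + a * delta t) * s * t - (a * t) * (s * delta t + t * delta s) by ring.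
by rewrite de e; ring.
Qed.

Definition frac_deriv (f : K) : K :=
  quotient_rule (\n_(repr f)) (\d_(repr f)).

Lemma frac_derivE (a s : R) : s != 0 -> frac_deriv (a%:F / s%:F) = quotient_rule a s.
Proof.
move=> s0; set f := _ / _; apply: quotient_rule_wd; rewrite ?denom_ratioP //.
have /eqP : a%:F / s%:F = (\n_(repr f))%:F / (\d_(repr f))%:F.
  exact: fraction_repr.
by rewrite eqr_div ?tofrac_eq0 ?denom_ratioP // -!tofracM tofrac_eq => /eqP.
Qed.

Lemma frac_deriv_tofrac (a : R) : frac_deriv a%:F = (delta a)%:F.
Proof.
have d1 : delta 1 = 0.
  have := deltaM 1 1; rewrite !mulr1 mul1r => /(canLR (addrK _)).
  by rewrite subrr.
rewrite -[a%:F]divr1 -[X in _ / X]tofrac1 frac_derivE ?oner_neq0 //.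
by rewrite /quotient_rule d1 mulr0 subr0 mulr1 tofrac1 expr1n divr1.
Qed.

Lemma frac_deriv_derivation : derivation_along (@idfun K) frac_deriv.
Proof.
have frac f : exists a s, s != 0 /\ f = a%:F / s%:F.
  exists (\n_(repr f)), (\d_(repr f)).
  by rewrite denom_ratioP -fraction_repr.
split=> f g; have [a [s [s0 ->]]] := frac f; have [b [t [t0 ->]]] := frac g;
  have [sF tF] : s%:F != 0 /\ t%:F != 0 by rewrite !tofrac_eq0.
- rewrite addf_div // -!tofracM -tofracD !frac_derivE ?mulf_neq0 //.
  rewrite /quotient_rule deltaD !deltaM !(tofracM, tofracD, tofracN).
  exact: quotient_ruleD.
- rewrite mulf_div -!tofracM !frac_derivE ?mulf_neq0 //.
  rewrite /quotient_rule !deltaM !(tofracM, tofracD, tofracN).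
  exact: quotient_ruleM.
Qed.

End FractionDerivation.

(** * Logarithmic brackets and the Jacobiator *)
Section LogBracket.
Variables (K : fieldType) (B : K -> K -> K).

Definition skew_biderivation : Prop :=
  (forall f g, B f g = - B g f) /\ forall f, derivation_along (@idfun K) (B f).

(** The bracket of logarithms, [{log f, log g}].  It is additive on products in
    each argument, and a log-canonical bracket is one for which it is constant
    on pairs of coordinates. *)
Definition log_bracket f g := B f g / (f * g).

Lemma bracketE f g : f != 0 -> g != 0 -> B f g = log_bracket f g * f * g.
Proof. by move=> f0 g0; rewrite /log_bracket; field; rewrite f0 g0. Qed.

Hypothesis derB : skew_biderivation.

Lemma log_bracketC f g : log_bracket f g = - log_bracket g f.
Proof. by rewrite /log_bracket derB.1 mulNr [f * g]mulrC. Qed.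

Lemma log_bracket_dlog f g : log_bracket f g = dlog idfun (B f) g / f.
Proof. by rewrite /log_bracket /dlog invfM mulrA mulrAC. Qed.

Lemma log_bracketMr f g h : g != 0 -> h != 0 ->
  log_bracket f (g * h) = log_bracket f g + log_bracket f h.
Proof.
by move=> g0 h0; rewrite !log_bracket_dlog (dlogM (derB.2 f)) // mulrDl.
Qed.

Lemma log_bracketMl f g h : g != 0 -> h != 0 ->
  log_bracket (g * h) f = log_bracket g f + log_bracket h f.
Proof.
move=> g0 h0; rewrite log_bracketC log_bracketMr // opprD.
by rewrite -!(log_bracketC _ f).
Qed.

Lemma log_bracketXzr f g (z : int) : g != 0 ->
  log_bracket f (g ^ z) = z%:~R * log_bracket f g.
Proof.
by move=> g0; rewrite !log_bracket_dlog (dlogXz (derB.2 f)) // -mulrA.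
Qed.

Lemma log_bracketXzl f g (z : int) : g != 0 ->
  log_bracket (g ^ z) f = z%:~R * log_bracket g f.
Proof.
by move=> g0; rewrite log_bracketC log_bracketXzr // -mulrN -log_bracketC.
Qed.

(** The only non-monomial expressions in the mutation formulas are the
    binomials [1 + X_k^(-z)]. *)
Lemma log_bracket1Dr f g : g != 0 ->
  log_bracket f (1 + g) = g / (1 + g) * log_bracket f g.
Proof.
move=> g0; rewrite !log_bracket_dlog /dlog (derB.2 f).1 (deriv1 (derB.2 f)) add0r /=.
by rewrite -{1}[B f g](divfK g0); ring.
Qed.

Definition jacobiator f g h := B f (B g h) + B g (B h f) + B h (B f g).

Lemma jacobiatorC f g h : jacobiator f g h = jacobiator g h f.
Proof. by rewrite /jacobiator -addrA addrC. Qed.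

Lemma biderivationN f g : B f (- g) = - B f g.
Proof. by apply/eqP; rewrite -addr_eq0 -(derB.2 f).1 addNr (deriv0 (derB.2 f)). Qed.

(** The Jacobiator is the commutator of [B f] and [B g] minus [B (B f g)], and
    a commutator of derivations is a derivation. *)
Lemma jacobiator_derivation f g : derivation_along (@idfun K) (jacobiator f g).
Proof.
have [skewB der] := derB.
have JE h : jacobiator f g h = B f (B g h) - B g (B f h) - B (B f g) h.
  by rewrite /jacobiator (skewB h f) biderivationN (skewB h).
split=> h1 h2; rewrite !JE /=.
  by rewrite !((der _).1); ring.
by rewrite !((der _).2) /= !((der _).1) !((der _).2) /=; ring.
Qed.

(** With [a], [b], [c] the structure constants, the three terms contribute
    [b(a - c)], [c(b - a)] and [a(c - b)] times [x y z]. *)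
Lemma jacobiator_log_canonical x y z a b c :
  B x y = a * (x * y) -> B y z = b * (y * z) -> B z x = c * (z * x) ->
  B x b = 0 -> B y c = 0 -> B z a = 0 -> jacobiator x y z = 0.
Proof.
have [skewB der] := derB => xy yz zx xb yc za.
rewrite /jacobiator xy yz zx !((der _).2) /= xb yc za.
by rewrite (skewB x z) (skewB y x) (skewB z y) xy yz zx; ring.
Qed.

End LogBracket.

(** * Poisson brackets are determined by the coordinates *)
Section Bracket.
Variables (F : fieldType) (s : seed) (B : torus_field F s -> torus_field F s -> torus_field F s).
Local Notation K := (torus_field F s).
Hypothesis (PB : poisson_structure B).

Lemma bracketDl f g h : B (f + g) h = B f h + B g h.
Proof. by have := pb_linear PB 1 f g h; rewrite !rmorph1 !mul1r. Qed.

Lemma bracketDr f g h : B f (g + h) = B f g + B f h.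
Proof. by rewrite pb_skew // bracketDl opprD -!pb_skew. Qed.

Lemma bracket_derivation f : derivation_along (@idfun K) (B f).
Proof. by split=> [g h|g h]; [exact: bracketDr|exact: (pb_leibniz PB)]. Qed.

(** Constants are Casimirs: [B f 1 = 0] by the Leibniz rule. *)
Lemma bracket_const f c : B f (torus_const s c) = 0.
Proof.
rewrite pb_skew // -[torus_const s c]mulr1 -[_ * 1]addr0 pb_linear //.
rewrite (pb_skew PB 1) (pb_skew PB 0) (deriv1 (bracket_derivation f)).
by rewrite (deriv0 (bracket_derivation f)) oppr0 mulr0 addr0 oppr0.
Qed.

Lemma bracket_skew_biderivation : skew_biderivation B.
Proof. by split; [exact: (pb_skew PB)|exact: bracket_derivation]. Qed.

End Bracket.

Lemma birational_rmorphism (F : fieldType) (s s' : seed)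
    (phi : torus_field F s' -> torus_field F s) :
  birational_iso phi ->
  exists psi : {rmorphism torus_field F s' -> torus_field F s}, phi = psi.
Proof.
move=> [phi_add phi_mul _ _].
pose psi : {rmorphism torus_field F s' -> torus_field F s} :=
  HB.pack phi (GRing.isZmodMorphism.Build _ _ _ phi_add)
    (GRing.isMonoidMorphism.Build _ _ _ phi_mul).
by exists psi.
Qed.

(** Both sides are derivations in each argument along the pullback and vanish
    on constants, so one extends the equality from coordinates to all functions
    in the second argument, then by skew-symmetry in the first. *)
Lemma poisson_map_of_coord (F : fieldType) (s s' : seed)
    (B : torus_field F s -> torus_field F s -> torus_field F s)
    (B' : torus_field F s' -> torus_field F s' -> torus_field F s')
    (phi : torus_field F s' -> torus_field F s) :
  birational_iso phi -> poisson_structure B -> poisson_structure B' ->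
  (forall i j, phi (B' (coord F i) (coord F j)) =
               B (phi (coord F i)) (phi (coord F j))) ->
  poisson_map B B' phi.
Proof.
move=> bi_phi PB PB' eqX; have phi_const := bi_const bi_phi.
have [psi phiE] := birational_rmorphism bi_phi.
move: eqX phi_const; rewrite {}phiE /poisson_map => {bi_phi phi} eqX phi_const.
have der1 f : derivation_along psi (fun g => psi (B' f g)).
  split=> g h; first by rewrite (bracketDr PB') rmorphD.
  by rewrite (pb_leibniz PB') rmorphD !rmorphM.
have der2 f : derivation_along psi (fun g => B (psi f) (psi g)).
  split=> g h; first by rewrite rmorphD (bracketDr PB).
  by rewrite rmorphM (pb_leibniz PB).
have const12 f c :
    psi (B' f (torus_const s' c)) = B (psi f) (psi (torus_const s' c)).
  by rewrite phi_const (bracket_const PB) (bracket_const PB') rmorph0.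
have coord_l i :
    (fun g => psi (B' (coord F i) g)) =1 (fun g => B (psi (coord F i)) (psi g)).
  exact: (torus_derivation_ext (der1 _) (der2 _)).
move=> f; apply: (torus_derivation_ext (der1 f) (der2 f)) => // i.
by rewrite (pb_skew PB') rmorphN coord_l -(pb_skew PB).
Qed.

(** * The log-canonical Poisson structure of a seed *)
Lemma leibniz_term (R : comRingType) (c a b g h b' : R) :
  c * (a * (b * h + g * b')) = c * (a * b) * h + g * (c * (a * b')).
Proof. ring. Qed.

Section ClusterPoissonStructure.
Variables (F : fieldType) (s : seed).
Local Notation K := (torus_field F s).
Local Notation P := {mpoly F[#|idx s|]}.

(** The Euler derivation [X_a d/dX_a].  It scales every monomial, so constant
    combinations of products of Euler derivations are the log-canonical
    brackets. *)
Definition euler_poly (a : 'I_#|idx s|) (p : P) : P := 'X_a * p^`M(a).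

Lemma euler_polyD a : {morph euler_poly a : p q / p + q}.
Proof. by move=> p q; rewrite /euler_poly mderivD mulrDr. Qed.

Lemma euler_polyM a p q :
  euler_poly a (p * q) = euler_poly a p * q + p * euler_poly a q.
Proof. by rewrite /euler_poly mderivM; ring. Qed.

Definition euler (i : idx s) : K -> K := frac_deriv (euler_poly (enum_rank i)).

Lemma euler_derivation i : derivation_along (@idfun K) (euler i).
Proof. exact: (frac_deriv_derivation (euler_polyD _) (@euler_polyM _)). Qed.

Lemma euler_const i c : euler i (torus_const s c) = 0.
Proof.
rewrite /euler /torus_const (frac_deriv_tofrac (@euler_polyM _)).
by rewrite /euler_poly mderivC mulr0 tofrac0.
Qed.

Lemma euler_coord i j : euler i (coord F j) = (i == j)%:R * coord F j.
Proof.
rewrite /euler /coord (frac_deriv_tofrac (@euler_polyM _)) /euler_poly mderivX mnm1E.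
rewrite (inj_eq enum_rank_inj) eq_sym; case: eqVneq => [->|_].
  by rewrite -[X in (X - _)%MM]add0m addmK scale1r mpolyX0 mulr1 mul1r.
by rewrite scale0r mulr0 tofrac0 mul0r.
Qed.

Lemma euler_linear i c f g :
  euler i (torus_const s c * f + g) = torus_const s c * euler i f + euler i g.
Proof.
have [eD eM] := euler_derivation i.
by rewrite eD eM euler_const mul0r add0r.
Qed.

Lemma monomial_neq0 (m : 'X_{1..#|idx s|}) : 'X_[m] != 0 :> P.
Proof.
by apply/eqP => /(congr1 (mcoeff m)); rewrite mcoeffX mcoeff0 eqxx => /eqP; rewrite oner_eq0.
Qed.

Lemma regular_poly (p : P) : regular (@tofrac P p : K).
Proof. by exists p, 0%MM; rewrite mpolyX0 tofrac1 divr1. Qed.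

Lemma regularD (f g : K) : regular f -> regular g -> regular (f + g).
Proof.
move=> [p [m ->]] [q [l ->]]; exists (p * 'X_[l] + q * 'X_[m]), (m + l)%MM.
by rewrite addf_div ?tofrac_eq0 ?monomial_neq0 // mpolyXD !(tofracM, tofracD).
Qed.

Lemma regularM (f g : K) : regular f -> regular g -> regular (f * g).
Proof.
move=> [p [m ->]] [q [l ->]]; exists (p * q), (m + l)%MM.
by rewrite mulf_div mpolyXD !tofracM.
Qed.

Lemma euler_regular i (f : K) : regular f -> regular (euler i f).
Proof.
move=> [p [m ->]]; rewrite /euler (frac_derivE (@euler_polyM _)) ?monomial_neq0 //.
rewrite /quotient_rule; eexists; exists (m + m)%MM.
by rewrite mpolyXD tofracM -expr2.
Qed.

Lemma ratr_const (q : rat) : ratr q = torus_const s (ratr q) :> K.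
Proof. by rewrite (fmorph_rat (torus_const s : {rmorphism F -> K})). Qed.

Lemma eps_hatC (i j : idx s) : eps_hat i j = - eps_hat j i.
Proof. exact: eps_skew. Qed.

(** The bivector is one half of
    [sum_(i, j) eps_hat i j (X_i d/dX_i) /\ (X_j d/dX_j)]. *)
Definition log_canonical_bracket (f g : K) : K :=
  \sum_i \sum_j ratr (eps_hat i j) * (euler i f * euler j g).
Local Notation B := log_canonical_bracket.

Lemma log_canonicalC f g : B f g = - B g f.
Proof.
rewrite /B exchange_big -sumrN; apply: eq_bigr => i _; rewrite -sumrN.
apply: eq_bigr => j _.
by rewrite eps_hatC ratrN_field mulNr [euler j f * _]mulrC.
Qed.

Lemma log_canonical_linear c f g h :
  B (torus_const s c * f + g) h = torus_const s c * B f h + B g h.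
Proof.
rewrite /B mulr_sumr -big_split; apply: eq_bigr => i _ /=.
rewrite mulr_sumr -big_split; apply: eq_bigr => j _ /=.
by rewrite euler_linear mulrDl mulrDr -mulrA [in LHS]mulrCA.
Qed.

Lemma log_canonical_derivation f : derivation_along (@idfun K) (B f).
Proof.
split=> g h; rewrite /B /=.
  rewrite -big_split; apply: eq_bigr => i _ /=; rewrite -big_split.
  by apply: eq_bigr => j _ /=; rewrite (euler_derivation j).1 !mulrDr.
rewrite mulr_suml mulr_sumr -big_split; apply: eq_bigr => i _ /=.
rewrite mulr_suml mulr_sumr -big_split; apply: eq_bigr => j _ /=.
rewrite (euler_derivation j).2 /=.
exact: leibniz_term.
Qed.

Lemma log_canonical_const f c : B f (torus_const s c) = 0.
Proof. by rewrite /B !big1 // => i _; rewrite big1 // => j _; rewrite euler_const !mulr0. Qed.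

Lemma log_canonical_coord i j :
  B (coord F i) (coord F j) = ratr (eps_hat i j) * coord F i * coord F j.
Proof.
rewrite /B (bigD1 i) //= [X in _ + X]big1 ?addr0 => [|a /negPf ai]; last first.
  by rewrite big1 // => b _; rewrite euler_coord ai !mul0r mulr0.
rewrite (bigD1 j) //= [X in _ + X]big1 ?addr0 => [|b /negPf bj]; last first.
  by rewrite [euler b _]euler_coord bj mul0r !mulr0.
by rewrite !euler_coord !eqxx !mul1r mulrA.
Qed.

Lemma log_canonical_regular f g : regular f -> regular g -> regular (B f g).
Proof.
move=> rf rg; rewrite /B.
have reg_sum (G : idx s -> K) : (forall i, regular (G i)) -> regular (\sum_i G i).
  move=> rG; apply: big_ind => [|f' g'|i _]; [|exact: regularD|exact: rG].
  by rewrite -tofrac0; apply: regular_poly.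
apply: (reg_sum) => i; apply: reg_sum => j; apply: regularM.
  by rewrite ratr_const; apply: regular_poly.
by apply: regularM; apply: euler_regular.
Qed.

Lemma log_canonical_biderivation : skew_biderivation B.
Proof. by split; [exact: log_canonicalC|exact: log_canonical_derivation]. Qed.

(** The Jacobiator is cyclic and a derivation in its last argument, so it
    vanishes once it does on triples of coordinates. *)
Lemma log_canonical_jacobi f g h : jacobiator B f g h = 0.
Proof.
have derB := log_canonical_biderivation.
have B0 f' : B f' 0 = 0 := deriv0 (derB.2 f').
have J0 f' g' : (forall i, jacobiator B f' g' (coord F i) = 0) ->
    jacobiator B f' g' =1 (fun=> 0).
  move=> h0; apply: (torus_derivation_ext (jacobiator_derivation derB f' g')) => //.
    by split=> x y; rewrite ?addr0 // mul0r mulr0 addr0.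
  move=> c; rewrite /jacobiator log_canonical_const B0.
  rewrite !(log_canonicalC (torus_const s c)) !log_canonical_const.
  by rewrite oppr0 B0 !addr0.
have J1 i j : jacobiator B (coord F i) (coord F j) =1 (fun=> 0).
  apply: J0 => k; apply: (@jacobiator_log_canonical _ _ derB _ _ _
    (ratr (eps_hat i j)) (ratr (eps_hat j k)) (ratr (eps_hat k i)));
    by [rewrite log_canonical_coord mulrA | rewrite ratr_const log_canonical_const].
have J2 i f' g' : jacobiator B (coord F i) f' g' = 0.
  by rewrite -jacobiatorC; apply: J0 => j; rewrite -2!jacobiatorC J1.
by apply: J0 => i; rewrite -jacobiatorC J2.
Qed.

Lemma log_canonical_cluster_bracket : cluster_bracket log_canonical_bracket.
Proof.
split; last exact: log_canonical_coord.
split.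
- exact: log_canonical_linear.
- exact: log_canonicalC.
- by move=> f g h; rewrite (log_canonical_derivation f).2.
- exact: log_canonical_jacobi.
- exact: log_canonical_regular.
Qed.

End ClusterPoissonStructure.

(** * The bracket of the mutated coordinates *)

(** Logarithmic derivative of [1 + y^(-z)] with respect to [log y]. *)
Definition dlog_factor (K : fieldType) (y : K) (z : int) : K :=
  y ^ (- z) / (1 + y ^ (- z)) * (- z)%:~R.

(** The identity [y/(1 + y) + (1/y)/(1 + 1/y) = 1]: it turns the rational
    functions of the pivot that appear in the bracket into a constant. *)
Lemma dlog_factor_jump (K : fieldType) (y : K) : y != 0 -> 1 + y != 0 ->
  dlog_factor y (-1) - dlog_factor y 1 = 1.
Proof.
move=> y0 y1; rewrite /dlog_factor opprK expr1z exprN1 mulrNz.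
by field; rewrite y0 addrC y1.
Qed.

Section MutationLogBracket.
Variables (K : fieldType) (B : K -> K -> K) (derB : skew_biderivation B).
Local Notation lb := (log_bracket B).

Lemma log_bracket_factor (x y : K) (z : int) : y != 0 ->
  lb x (1 + y ^ (- z)) = dlog_factor y z * lb x y.
Proof.
move=> y0; rewrite (log_bracket1Dr derB) ?expfz_neq0 //.
by rewrite (log_bracketXzr derB) // mulrA.
Qed.

Lemma log_bracket_factors (y : K) (z z' : int) : y != 0 -> lb y y = 0 ->
  lb (1 + y ^ (- z)) (1 + y ^ (- z')) = 0.
Proof.
move=> y0 yy; rewrite log_bracket_factor // (log_bracketC derB).
by rewrite log_bracket_factor // yy mulr0 oppr0 mulr0.
Qed.

(** The two binomials commute since both are functions of the pivot [y], so
    only the cross terms survive. *)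
Lemma exchange_log_bracket (x x' y : K) (z z' n n' : int) :
  x != 0 -> x' != 0 -> y != 0 -> 1 + y ^ (- z) != 0 -> 1 + y ^ (- z') != 0 ->
  lb y y = 0 ->
  lb (x * (1 + y ^ (- z)) ^ (- n)) (x' * (1 + y ^ (- z')) ^ (- n')) =
  lb x x' - n'%:~R * dlog_factor y z' * lb x y + n%:~R * dlog_factor y z * lb x' y.
Proof.
move=> x0 x'0 y0 u0 u'0 yy.
rewrite (log_bracketMr derB) ?expfz_neq0 // !(log_bracketMl derB) ?expfz_neq0 //.
rewrite !(log_bracketXzr derB) // !(log_bracketXzl derB) //.
rewrite log_bracket_factors // log_bracket_factor //.
rewrite (log_bracketC derB (1 + _) x') log_bracket_factor // !mulrNz; ring.
Qed.

Lemma exchange_log_bracket_pivot (x y : K) (z n : int) :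
  x != 0 -> y != 0 -> 1 + y ^ (- z) != 0 -> lb y y = 0 ->
  lb (x * (1 + y ^ (- z)) ^ (- n)) y^-1 = - lb x y.
Proof.
move=> x0 y0 u0 yy; rewrite -exprN1 (log_bracketXzr derB) // mulrNz mulN1r.
rewrite (log_bracketMl derB) ?expfz_neq0 // (log_bracketXzl derB) //.
by rewrite (log_bracketC derB (1 + _) y) log_bracket_factor // yy mulr0 oppr0 mulr0 addr0.
Qed.

End MutationLogBracket.

(** The correction in the matrix mutation rule, case by case in the signs of
    [a = eps_hat i k] and [b = eps_hat j k]: equal signs make the two values of
    [theta] cancel, opposite signs leave the jump, whose sign turns [a] into
    [`|a|]. *)
Lemma ratr_sign_cases (K : fieldType) (theta : int -> K) (a b h : rat) (d : nat) :
  [pchar K] =i pred0 -> theta (-1) - theta 1 = 1 ->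
  ratr (h - (if a * b < 0 then `|a| * b * d%:R else 0)) =
  ratr h - ratr b * d%:R * theta (sgz b) * ratr a
         + ratr a * d%:R * theta (sgz a) * ratr b.
Proof.
move=> charK jump; have [rM rD] := (ratrM_pchar0 charK, ratrD_pchar0 charK).
have ratr0 : ratr 0 = 0 :> K := ratr_nat K 0.
rewrite rD ratrN_field -!addrA; congr (_ + _).
have -> : - (ratr b * d%:R * theta (sgz b) * ratr a) +
    ratr a * d%:R * theta (sgz a) * ratr b =
    ratr a * ratr b * d%:R * (theta (sgz a) - theta (sgz b)) by ring.
case: (sgzP a) => [->|a0|a0]; first by rewrite !mul0r ltxx ratr0 oppr0 !mul0r.
- rewrite pmulr_rlt0 //; case: (sgzP b) => [->|b0|b0].
  + by rewrite ratr0 oppr0 mulr0 !mul0r.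
  + by rewrite subrr mulr0 ratr0 oppr0.
  + by rewrite !rM ratr_nat -[theta 1 - _]opprB jump; ring.
- rewrite nmulr_rlt0 //; case: (sgzP b) => [->|b0|b0].
  + by rewrite ratr0 oppr0 mulr0 !mul0r.
  + by rewrite !rM ratrN_field ratr_nat jump; ring.
  + by rewrite subrr mulr0 ratr0 oppr0.
Qed.

Section MutationPoisson.
Variables (F : fieldType) (charF0 : [pchar F] =i pred0).
Variables (s : seed) (k : idx s) (hk : k \notin frozen s).
Local Notation K := (torus_field F s).

Lemma eps_hatE (i j : idx s) : eps i j = eps_hat i j * (mult j)%:R.
Proof. by rewrite /eps_hat divfK // pnatr_eq0 -lt0n mult_gt0. Qed.

Lemma eps_hat_diag (i : idx s) : eps_hat i i = 0.
Proof.
have := eps_hatC i i => /eqP; rewrite -addr_eq0 -mulr2n mulrn_eq0 /=.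
by move/eqP.
Qed.

Lemma eps_hat_mutate_pivot (i : idx s) :
  @eps_hat (mutate hk) i k = - @eps_hat s i k.
Proof. by rewrite /eps_hat /= /mut_eps eqxx orbT mulNr. Qed.

Lemma eps_hat_mutate (i j : idx s) : i != k -> j != k ->
  @eps_hat (mutate hk) i j = @eps_hat s i j -
    (if eps_hat i k * eps_hat j k < 0 then `|eps_hat i k| * eps_hat j k * (mult k)%:R
     else 0).
Proof.
move=> ik jk; have d0 (l : idx s) : 0 < (mult l)%:R :> rat by rewrite ltr0n mult_gt0.
rewrite [LHS]/eps_hat /= /mut_eps eq_sym (negPf ik) eq_sym (negPf jk) /=.
have -> : (eps i k * eps k j <= 0) = (0 <= eps_hat i k * eps_hat j k).
  rewrite (eps_hatE i k) (eps_hatE k j) (eps_hatC k j) mulrACA.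
  by rewrite pmulr_lle0 ?mulr_gt0 // mulrN oppr_le0.
rewrite leNgt; case: (_ < 0) => /=; last by rewrite subr0.
rewrite mulrDl; congr (_ + _).
rewrite -[LHS]mulrA -/(eps_hat k j) (eps_hatC k j).
by rewrite (eps_hatE i k) normrM (gtr0_norm (d0 k)); ring.
Qed.

Lemma mutation_exponent (i : idx s) :
  (numq (eps i k))%:~R = ratr (eps_hat i k) * (mult k)%:R :> K.
Proof.
rewrite -ratr_int numqK; last by rewrite eps_int // (negPf hk) andbF.
by rewrite eps_hatE (ratrM_pchar0 (torus_pchar0 s charF0)) ratr_nat.
Qed.

Lemma sgz_eps (i : idx s) : sgz (eps i k) = sgz (eps_hat i k).
Proof. by rewrite eps_hatE sgzM [sgz (mult k)%:R]gtr0_sgz ?mulr1 // ltr0n mult_gt0. Qed.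

Lemma ratr_eps_hat_mutate (i j : idx s) : i != k -> j != k ->
  ratr (@eps_hat (mutate hk) i j) = ratr (eps_hat i j)
   - (numq (eps j k))%:~R * dlog_factor (coord F k) (sgz (eps j k)) * ratr (eps_hat i k)
   + (numq (eps i k))%:~R * dlog_factor (coord F k) (sgz (eps i k)) * ratr (eps_hat j k)
   :> K.
Proof.
move=> ik jk; have charK := torus_pchar0 s charF0.
rewrite eps_hat_mutate // !mutation_exponent !sgz_eps.
apply: (@ratr_sign_cases _ (dlog_factor (coord F k))) => //.
exact: (dlog_factor_jump (coord_neq0 F k) (coordD1_neq0 F k)).
Qed.

Lemma mut_coord_neq0 (i : idx s) : @mut_coord F s k i != 0.
Proof.
rewrite /mut_coord; case: (i == k); first by rewrite invr_eq0 coord_neq0.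
by rewrite mulf_neq0 ?coord_neq0 // expfz_neq0 // mutation_factor_neq0.
Qed.

(** The logarithm of a mutated coordinate is that of the old one plus a multiple
    of the logarithm of a binomial in the pivot, so additivity reduces the
    bracket to that of the old coordinates; pairs that contain the pivot are
    reduced by skew-symmetry to those with the pivot in second place. *)
Lemma mutation_log_bracket (B : K -> K -> K) (i j : idx s) : cluster_bracket B ->
  log_bracket B (mut_coord F k i) (mut_coord F k j) =
  ratr (@eps_hat (mutate hk) i j).
Proof.
move=> [PB BX]; have derB := bracket_skew_biderivation PB.
have lbX a b : log_bracket B (coord F a) (coord F b) = ratr (eps_hat a b).
  by rewrite /log_bracket BX -[in X in X / _]mulrA mulfK // mulf_neq0 ?coord_neq0.
have ratr0 : ratr 0 = 0 :> K by exact: (ratr_nat K 0).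
have lbkk : log_bracket B (coord F k) (coord F k) = 0 by rewrite lbX eps_hat_diag.
have X0 a := coord_neq0 F (s := s) a.
have U0 a : 1 + coord F k ^ (- sgz (eps a k)) != 0 by exact: mutation_factor_neq0.
have lb_pivot a : log_bracket B (mut_coord F k a) (mut_coord F k k) =
    ratr (@eps_hat (mutate hk) a k).
  rewrite eps_hat_mutate_pivot ratrN_field /mut_coord eqxx; case: (eqVneq a k) => [->|ak].
    rewrite -exprN1 (log_bracketXzr derB) ?(log_bracketXzl derB) //.
    by rewrite lbkk !mulr0 eps_hat_diag ratr0 oppr0.
  by rewrite (exchange_log_bracket_pivot derB) // lbX.
case: (eqVneq j k) => [->|jk]; first exact: lb_pivot.
case: (eqVneq i k) => [->|ik].
  by rewrite (log_bracketC derB) lb_pivot (@eps_hatC (mutate hk) k) ratrN_field.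
have vE a : a != k -> mut_coord F k a =
    coord F a * (1 + coord F k ^ (- sgz (eps a k))) ^ (- numq (eps a k)).
  by move=> /negPf ak; rewrite /mut_coord ak.
rewrite (ratr_eps_hat_mutate ik jk) (vE i ik) (vE j jk).
by rewrite (exchange_log_bracket derB _ _ (X0 i) (X0 j) (X0 k) (U0 i) (U0 j) lbkk) !lbX.
Qed.

End MutationPoisson.

(** * Cluster transformations are Poisson *)
Section ClusterPoisson.
Variables (F : fieldType) (charF0 : [pchar F] =i pred0).

Lemma mutation_poisson (s : seed) (k : idx s) (hk : k \notin frozen s)
    (B : torus_field F s -> torus_field F s -> torus_field F s)
    (B' : torus_field F (mutate hk) -> torus_field F (mutate hk) -> torus_field F (mutate hk)) :
  cluster_bracket B -> cluster_bracket B' ->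
  poisson_map B B' (cluster_pullback F (CMut hk)).
Proof.
move=> cB cB'; have bi := cluster_pullback_birational charF0 (CMut hk).
apply: poisson_map_of_coord => //; [exact: cB.1|exact: cB'.1|move=> i j].
have [vw wv] := mutation_left_inverses charF0 hk.
have [psi psiE] := birational_rmorphism bi.
have psiX a : psi (coord F a) = mut_coord F k a.
  by have := pullback_coord vw a; rewrite -[pullback_of _]/(cluster_pullback F (CMut hk)) psiE.
rewrite psiE cB'.2 2!(rmorphM psi) (fmorph_rat psi) !psiX.
rewrite [RHS](@bracketE _ B) ?mut_coord_neq0 //.
by rewrite (mutation_log_bracket charF0 hk i j cB).
Qed.

Lemma iso_poisson (s s' : seed) (sigma : seed_iso s s')
    (B : torus_field F s -> torus_field F s -> torus_field F s)
    (B' : torus_field F s' -> torus_field F s' -> torus_field F s') :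
  cluster_bracket B -> cluster_bracket B' ->
  poisson_map B B' (cluster_pullback F (CIso sigma)).
Proof.
move=> cB cB'; have bi := cluster_pullback_birational charF0 (CIso sigma).
apply: poisson_map_of_coord => //; [exact: cB.1|exact: cB'.1|move=> i j].
have [vw wv] := iso_left_inverses F sigma.
have [psi psiE] := birational_rmorphism bi.
have psiX a : psi (coord F a) = coord F (iso_inv sigma a).
  by have := pullback_coord vw a; rewrite -[pullback_of _]/(cluster_pullback F (CIso sigma)) psiE.
rewrite psiE cB'.2 2!(rmorphM psi) (fmorph_rat psi) !psiX cB.2.
rewrite -[in LHS](iso_invK sigma i) -[in LHS](iso_invK sigma j).
by rewrite /eps_hat iso_eps iso_mult !iso_funK.
Qed.

Lemma cluster_pullback_poisson (s s' : seed) (c : cluster_trans s s')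
    (B : torus_field F s -> torus_field F s -> torus_field F s)
    (B' : torus_field F s' -> torus_field F s' -> torus_field F s') :
  cluster_bracket B -> cluster_bracket B' ->
  poisson_map B B' (cluster_pullback F c).
Proof.
elim: c B B' => {s s'} [s k hk|s s' sigma|s1 s2 s3 c1 IH1 c2 IH2] B B' cB cB'.
- exact: mutation_poisson.
- exact: iso_poisson.
(* The hypotheses give no bracket on the intermediate torus. *)
- have cB2 := log_canonical_cluster_bracket F s2.
  move=> f g /=; rewrite (IH2 _ _ cB2 cB'); exact: (IH1 _ _ cB cB2).
Qed.

End ClusterPoisson.

Theorem lemma2p6 (F : fieldType) (charF0 : [pchar F] =i pred0) :
  (forall (s s' : seed) (c : cluster_trans s s'),
     birational_iso (cluster_pullback F c) /\
     forall (B : torus_field F s -> torus_field F s -> torus_field F s)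
            (B' : torus_field F s' -> torus_field F s' -> torus_field F s'),
       cluster_bracket B -> cluster_bracket B' ->
       poisson_map B B' (cluster_pullback F c))
  /\
  (forall s0 : seed,
     exists P : forall s : seed,
         torus_field F s -> torus_field F s -> torus_field F s,
       space_poisson_structure s0 P /\
       forall s : seed, seed_equiv s0 s -> cluster_bracket (P s)).
Proof.
split=> [s s' c|s0].
  split; first exact: cluster_pullback_birational.
  exact: cluster_pullback_poisson.
have cB s := log_canonical_cluster_bracket F s.
exists (fun s => @log_canonical_bracket F s); split; last by [].
split=> [s _|s s' c _ _]; first exact: (cB s).1.
exact: cluster_pullback_poisson.
Qed.
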